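(* Let $(X,T)$ be a topological dynamical system with (at least) two different ergodic measures $\mu$ and $\nu$, both having full topological support. Then there exist a dense $G_\delta$-set $B\subset X$ and a continuous function $f:X\to\mathbb R$ such that for every $x\in B$ the ergodic averages $$A_n(f,x)=\frac1n\sum_{i=0}^{n-1}f(T^ix)$$ oscillate (i.e. the sequence $(A_n(f,x))_{n\ge1}$ does not converge).
   Context: A topological dynamical system $(X,T)$ consists of a compact metric space $X$ and a continuous surjection $T:X\to X$. Ergodic measures are ergodic $T$-invariant Borel probability measures on $X$. A measure has full topological support if every nonempty open subset of $X$ has positive measure. *)

(* Defs.v *)
From HB Require Import structures.
From mathcomp Require Import all_boot all_order all_algebra.
From mathcomp Require Import all_classical all_reals all_analysis.
From mathcomp Require Import borel_hierarchy.

Set Implicit Arguments.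
Unset Strict Implicit.
Unset Printing Implicit Defensive.

Import Order.TTheory GRing.Theory Num.Theory.
Import numFieldNormedType.Exports.

Local Open Scope classical_set_scope.
Local Open Scope ring_scope.

(* Measurable types are pointed in the library, so a metric space needs a base
   point to carry its Borel sigma-algebra. This only excludes the empty space,
   on which there is no probability measure. *)
#[short(type="pmetricType")]
HB.structure Definition PointedMetric (K : numDomainType) :=
  { M of Metric K M & Pointed M }.

Notation borel X := (g_sigma_algebraType (@open X)).

Section dynamics.
Context {R : realType} {X : pmetricType R}.
Implicit Types (T : X -> X) (mu nu : probability (borel X) R) (f : X -> R).

Definition topological_dynamical_system T :=
  [/\ compact [set: X], continuous T & set_surj [set: X] [set: X] T].

Definition invariant_measure T mu :=
  forall A : set (borel X), measurable A -> mu (T @^-1` A) = mu A.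

Definition ergodic_measure T mu :=
  invariant_measure T mu /\
  forall A : set (borel X), measurable A -> T @^-1` A = A ->
    mu A = 0%E \/ mu A = 1%E.

(* The library's measures are functions on all subsets of X whose values are
   meaningful only on the measurable ones, so the Leibniz inequality
   [mu <> nu] would be too weak. *)
Definition different_measures mu nu :=
  exists2 A : set (borel X), measurable A & mu A <> nu A.

Definition full_support mu :=
  forall U : set X, open U -> U !=set0 -> (0 < mu U)%E.

(* [ergodic_average T f x 0] is 0, which has no effect on convergence. *)
Definition ergodic_average T f (x : X) : R^nat :=
  fun n => n%:R^-1 * \sum_(0 <= i < n) f (iter i T x).

End dynamics.

(* Main.v *)
Require Import Defs.
From mathcomp Require Import all_boot all_order all_algebra.
From mathcomp Require Import all_classical all_reals all_analysis.
From mathcomp Require Import borel_hierarchy measurable_realfun.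
From mathcomp Require Import lra.
Import Order.TTheory GRing.Theory Num.Theory.
Import numFieldNormedType.Exports.
Local Open Scope classical_set_scope.
Local Open Scope ring_scope.

(* Borel probabilities that differ do so on some open set U, whose indicator is
   the increasing limit of the functions min(k d(x, X \ U), 1); hence some
   continuous f has different integrals against mu and nu, say
   int f dnu < b < a < int f dmu. The invariant set E where
   limsup_n A_n(f, x) <= a is mu-null: otherwise it has full measure by
   ergodicity, the functions max(A_n(f, .) - a, 0) are bounded and tend to 0
   almost everywhere, and dominated convergence contradicts
   int A_n(f, .) dmu = int f dmu > a. By full support E contains no nonempty
   open set, so the open set of the x having some n >= N with A_n(f, x) > a is
   dense. The same argument for nu and -f gives density for A_n(f, x) < b, and
   Baire's theorem concludes. *)

(** * Baire category in compact regular spaces *)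

Lemma compact_regular_baire (X : ptopologicalType) (O : (set X)^nat) :
  compact [set: X] -> regular_space X ->
  (forall n, open (O n)) -> (forall n, dense (O n)) -> dense (\bigcap_n O n).
Proof.
move=> cX rX oO dO W W0 oW.
(* Putting the conditions on [p.2] inside the existential makes it hold for every [p], so that
   choice yields a total [g]; [set0] is the dummy answer when they fail. *)
have /choice[g gP] (p : nat * set X) : exists V : set X,
    open p.2 -> p.2 !=set0 ->
    [/\ open V, V !=set0 & closure V `<=` p.2 `&` O p.1].
  case: p => n V /=.
  have [[oV V0]|nV] := pselect (open V /\ V !=set0); last first.
    by exists set0 => oV V0; exfalso; apply: nV.
  have [x VOx] := dO n V V0 oV.
  have [|A Ax clA] := rX x (V `&` O n).
    by apply: open_nbhs_nbhs; split => //; exact: openI.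
  exists A^° => _ _; split; first exact: open_interior.
    by exists x.
  by apply: subset_trans clA; apply: closureS; exact: interior_subset.
pose V := fix V n := if n is m.+1 then g (m, V m) else W.
have VP n : open (V n) /\ V n !=set0.
  by elim: n => [//|n [oV V0]] /=; have [] := gP (n, V n) oV V0.
have clV n : closure (V n.+1) `<=` V n `&` O n.
  by have [oV V0] := VP n; have [] := gP (n, V n) oV V0.
have Vsub m n : (m <= n)%N -> V n `<=` V m.
  move=> /subnK <-; elim: (n - m)%N => // k ih x /subset_closure /clV[+ _].
  exact: ih.
(* Nonempty and decreasing, the [V n] generate a proper filter. Compactness gives it a cluster
   point, which lies in the closure of every [V n.+1], hence in every [V n] and [O n]. *)
have FF : ProperFilter (filter_from [set: nat] V).
  apply: filter_from_proper; last by move=> n _; have [] := VP n.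
  apply: filter_from_filter; first by exists 0%N.
  move=> m n _ _; exists (maxn m n) => // x Vx; split; apply: Vsub Vx.
    exact: leq_maxl.
  exact: leq_maxr.
have [|x [_ Fx]] := cX _ FF; first by exists 0%N.
have VOx n : (V n `&` O n) x.
  by apply: clV => B Bx; apply: Fx => //; exists n.+1.
exists x; split; first by have [] := VOx 0%N.
by move=> n _; have [] := VOx n.
Qed.

(** * Continuous functions and Borel probabilities *)

Lemma measurable_continuous (R : realType) (X : pmetricType R) (f : X -> R) :
  continuous f -> measurable_fun [set: borel X] (f : borel X -> R).
Proof.
move=> cf; apply: (measurability _ (RGenOpens.measurableE R)).
move=> _ [_ [a [b ->]] <-]; rewrite setTI; apply: sub_sigma_algebra.
by move/continuousP : cf; apply; exact: interval_open.
Qed.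

Definition inf_dist {R : realType} {X : pmetricType R} (A : set X)
    (x : X) : R :=
  inf [set mdist x y | y in A].

Lemma inf_dist_ge0 (R : realType) (X : pmetricType R) (A : set X) x :
  A !=set0 -> 0 <= inf_dist A x.
Proof.
move=> [a Aa]; apply: lb_le_inf; first by exists (mdist x a); exists a.
by move=> _ [y _ <-]; exact: mdist_ge0.
Qed.

Lemma inf_dist_le (R : realType) (X : pmetricType R) (A : set X) x a :
  A a -> inf_dist A x <= mdist x a.
Proof.
move=> Aa; apply: ge_inf; last by exists a.
by exists 0 => _ [y _ <-]; exact: mdist_ge0.
Qed.

Lemma inf_dist_lipschitz (R : realType) (X : pmetricType R) (A : set X) x y :
  A !=set0 -> inf_dist A x <= mdist x y + inf_dist A y.
Proof.
move=> [a Aa]; rewrite -lerBlDl; apply: lb_le_inf.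
  by exists (mdist y a); exists a.
move=> _ [b Ab <-]; rewrite lerBlDl.
by apply: le_trans (metric_triangle x y b); exact: inf_dist_le.
Qed.

Lemma inf_dist_continuous (R : realType) (X : pmetricType R) (A : set X) :
  A !=set0 -> continuous (inf_dist A).
Proof.
move=> A0 x; apply/cvgrPdist_lt => e e0; near=> y.
have xye : mdist x y < e.
  near: y; have := nbhsx_ballx x e e0.
  by apply: filterS => y; rewrite ballEmdist.
rewrite (le_lt_trans _ xye)// ler_norml lerBlDr inf_dist_lipschitz// andbT.
by rewrite lerNl opprB lerBlDr metric_sym inf_dist_lipschitz.
Unshelve. all: by end_near. Qed.

Lemma inf_dist_gt0 (R : realType) (X : pmetricType R) (U : set X) x :
  open U -> ~` U !=set0 -> U x -> 0 < inf_dist (~` U) x.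
Proof.
move=> oU [a Ua] Ux.
have /nbhs_ballP[e /= e0 eU] : nbhs x U by exact: open_nbhs_nbhs.
apply: (lt_le_trans e0); apply: lb_le_inf.
  by exists (mdist x a); exists a.
move=> _ [y Uy <-]; rewrite leNgt; apply/negP => xye; apply: Uy; apply: eU.
by rewrite ballEmdist.
Qed.

(** Open sets are stable under intersection and generate the Borel sigma-algebra, so agreement on
    open sets suffices. *)
Lemma probability_eq_continuous (R : realType) (X : pmetricType R)
    (mu nu : probability (borel X) R) :
  (forall f : X -> R, continuous f ->
     (\int[mu]_x (f x)%:E = \int[nu]_x (f x)%:E)%E) ->
  forall A : set (borel X), measurable A -> mu A = nu A.
Proof.
move=> munu.
apply: (@measure_unique _ R (borel X) (@open X) (fun=> setT)) => //.
- by move=> A B; exact: openI.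
- by move=> _; exact: openT.
- by apply/seteqP; split => // x _; exists 0%N.
- move=> U oU; have mU : measurable (U : set (borel X)).
    exact: sub_sigma_algebra.
  (* The whole space is treated apart: the distance to its empty complement would be an infimum over
     the empty set. *)
  have [->|UT] := eqVneq U setT.
    by transitivity (1%E : \bar R); [|symmetry]; exact: probability_setT.
  have UC0 : ~` U !=set0.
    by apply/set0P; apply: contra_neq UT => UC0; rewrite -(setCK U) UC0 setC0.
  pose f k x := Num.min (k%:R * inf_dist (~` U) x) 1.
  have cf k : continuous (f k).
    move=> x; apply: (@continuous_min _ _
      (fun x => k%:R * inf_dist (~` U) x) (cst 1)).
      apply: (@continuousM _ _ (cst k%:R)); first exact: cst_continuous.
      exact: inf_dist_continuous.
    exact: cst_continuous.
  have f_cvg (x : borel X) : (f k x)%:E @[k --> \oo] --> (\1_U x : R)%:E.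
    apply: cvg_EFin; first exact: nearW.
    rewrite /comp/= indicE; have [/set_mem Ux|/negP Ux] := boolP (x \in U).
      (* Inside [U] the distance d is positive, so the minimum equals 1 as soon as k > 1/d; outside
         [U] the distance is 0 and so is every [f k x]. *)
      apply: cvg_near_cst; near=> k; rewrite /f; apply/min_idPr.
      have d0 := inf_dist_gt0 R X U x oU UC0 Ux.
      rewrite -ler_pdivrMr// ltW//; near: k; exact: nbhs_infty_gtr.
    apply: cvg_near_cst; apply: nearW => k; rewrite /f.
    have -> : inf_dist (~` U) x = 0.
      apply/le_anti; rewrite inf_dist_ge0// andbT -(mdistxx x).
      by apply: inf_dist_le => Ux'; apply: Ux; exact: mem_set.
    by rewrite mulr0 min_l.
  have int_cvg (P : probability (borel X) R) :
      (\int[P]_x (f k x)%:E)%E @[k --> \oo] --> P U.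
    have [] := @dominated_convergence _ (borel X) R P setT measurableT
      (fun k x => (f k x)%:E) (fun x => (\1_U x)%:E) (cst 1%E).
    - move=> k; apply/measurable_EFinP; exact: measurable_continuous.
    - by apply/measurable_EFinP; exact: measurable_indic.
    - by apply: aeW => x _; exact: f_cvg.
    - exact: finite_measure_integrable_cst.
    - apply: aeW => x k _; rewrite lee_fin ger0_norm /f ?ge_min ?lexx ?orbT//.
      by rewrite le_min ler01 mulr_ge0// inf_dist_ge0.
    by move=> _ _; rewrite integral_indic// setIT.
  have int_mu := int_cvg mu.
  have int_E : (fun k => \int[mu]_x (f k x)%:E)%E =
      (fun k => \int[nu]_x (f k x)%:E)%E by apply/funext => k; exact: munu.
  rewrite int_E in int_mu.
  exact: (cvg_unique (@ereal_hausdorff R) int_mu (int_cvg nu)).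
- by move=> _; apply: le_lt_trans (ltry 1); exact: probability_le1.
Unshelve. all: by end_near. Qed.

Lemma continuous_bounded (R : realType) (X : pmetricType R) (f : X -> R) :
  compact [set: X] -> continuous f ->
  exists2 M : R, 0 <= M & forall x, `|f x| <= M.
Proof.
move=> cX cf; have : compact (f @` [set: X]).
  by apply: continuous_compact => //; exact: continuous_subspaceT.
move=> /compact_bounded[M [_ fM]].
(* Every number strictly above [M] is a bound, in particular [M + 1]; its nonnegativity is read off
   at [point]. *)
have {}fM x : `|f x| <= M + 1 by apply: fM; [rewrite ltrDl|exists x].
by exists (M + 1) => //; exact: le_trans (fM point).
Qed.

Lemma continuous_integrable (R : realType) (X : pmetricType R) (f : X -> R)
    (mu : probability (borel X) R) :
  compact [set: X] -> continuous f ->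
  mu.-integrable [set: borel X] (EFin \o (f : borel X -> R)).
Proof.
move=> cX cf; have [M M0 fM] := continuous_bounded _ _ _ cX cf.
apply: measurable_bounded_integrable => //.
- by apply: le_lt_trans (ltry 1); exact: probability_le1.
- exact: measurable_continuous.
- exists M; split => [|N MN x _]; first exact: ger0_real.
  by rewrite /= (le_trans (fM x))// ltW.
Qed.

(** * Continuity and integrals of ergodic averages *)

Lemma continuous_iter (X : topologicalType) (T : X -> X) n :
  continuous T -> continuous (iter n T).
Proof.
move=> cT; elim: n => [|n ih] x; first exact: cvg_id.
by apply: (@continuous_comp _ _ _ (iter n T) T); [exact: ih|exact: cT].
Qed.

Lemma birkhoff_sum_continuous (R : realType) (X : topologicalType)
    (T : X -> X) (f : X -> R) n :
  continuous T -> continuous f ->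
  continuous (fun x => \sum_(0 <= i < n) f (iter i T x)).
Proof.
move=> cT cf; elim: n => [|n ih].
  rewrite (_ : (fun=> _) = cst 0); first by move=> x; exact: cst_continuous.
  by apply/funext => x; rewrite big_geq.
rewrite (_ : (fun=> _) =
    (fun x => \sum_(0 <= i < n) f (iter i T x)) \+ (f \o iter n T)).
  move=> x; apply: continuousD; first exact: ih.
  by apply: continuous_comp; [exact: continuous_iter|exact: cf].
by apply/funext => x; rewrite big_nat_recr.
Qed.

Lemma ergodic_average_continuous (R : realType) (X : pmetricType R)
    (T : X -> X) (f : X -> R) n :
  continuous T -> continuous f -> continuous (fun x => ergodic_average T f x n).
Proof.
move=> cT cf x; apply: (@continuousM _ _ (cst n%:R^-1)).
  exact: cst_continuous.
exact: birkhoff_sum_continuous.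
Qed.

(** Change of variables turns the left side into an integral against the pushforward of [mu] by [T],
    which agrees with [mu] on Borel sets. *)
Lemma invariant_Rintegral (R : realType) (X : pmetricType R) (T : X -> X)
    (f : X -> R) (mu : probability (borel X) R) :
  compact [set: X] -> continuous T -> continuous f -> invariant_measure T mu ->
  \int[mu]_x f (T x) = \int[mu]_x f x.
Proof.
move=> cX cT cf imu; rewrite /Rintegral; congr fine.
have mT : measurable_fun [set: borel X] (T : borel X -> borel X).
  apply: (@measurability _ _ (borel X) (borel X) setT T (@open X)) => //.
  move=> _ [U oU <-]; rewrite setTI; apply: sub_sigma_algebra.
  by move/continuousP : cT; exact.
transitivity (\int[pushforward mu (T : borel X -> borel X)]_x (f x)%:E)%E.
  rewrite integral_pushforward//.
  - by apply/measurable_EFinP; exact: measurable_continuous.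
  - apply: (@continuous_integrable _ _ (f \o T)) => // x.
    by apply: continuous_comp; [exact: cT|exact: cf].
by apply: eq_measure_integral => A mA _; exact: imu.
Qed.

Lemma Rintegral_ergodic_average (R : realType) (X : pmetricType R) (T : X -> X)
    (f : X -> R) (mu : probability (borel X) R) n : (0 < n)%N ->
  compact [set: X] -> continuous T -> continuous f -> invariant_measure T mu ->
  \int[mu]_x ergodic_average T f x n = \int[mu]_x f x.
Proof.
move=> n0 cX cT cf imu.
have cfT k : continuous (f \o iter k T).
  by move=> x; apply: continuous_comp; [exact: continuous_iter|exact: cf].
have csum k := @birkhoff_sum_continuous R X T f k cT cf.
have int_iter k : \int[mu]_x f (iter k T x) = \int[mu]_x f x.
  elim: k => // k <-.
  (* Peeling off the innermost [T] exhibits the integrand as [f \o iter k T] evaluated at [T x], so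
     invariance applies. *)
  under eq_Rintegral do rewrite iterSr.
  exact: (@invariant_Rintegral _ _ _ (f \o iter k T)).
rewrite /ergodic_average RintegralZl//; last exact: continuous_integrable.
suff -> k : \int[mu]_x (\sum_(0 <= i < k) f (iter i T x)) =
    k%:R * \int[mu]_x f x.
  by rewrite mulrA mulVf ?mul1r// pnatr_eq0 -lt0n.
elim: k => [|k ih].
  under eq_Rintegral do rewrite big_geq//.
  by rewrite mul0r Rintegral_cst// mul0r.
under eq_Rintegral do rewrite big_nat_recr//=.
rewrite RintegralD//; [|exact: continuous_integrable
  |exact: (continuous_integrable _ _ (f \o iter k T))].
by rewrite ih int_iter -natr1 mulrDl mul1r.
Qed.

(** * The invariant set where the upper limit of the averages is at most a *)

Lemma ergodic_average_shift (R : realType) (X : pmetricType R) (T : X -> X)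
    (f : X -> R) x n :
  ergodic_average T f (T x) n - ergodic_average T f x n =
  n%:R^-1 * (f (iter n T x) - f x).
Proof.
rewrite /ergodic_average -mulrBr -sumrB; congr (_ * _).
under eq_bigr do rewrite -iterSr.
exact: (@telescope_sumr _ 0 n (fun i => f (iter i T x))).
Qed.

(** After telescoping only two boundary terms remain, so the difference is at most 2M/n for a bound
    M of |f|. *)
Lemma ergodic_average_shift_small (R : realType) (X : pmetricType R)
    (T : X -> X) (f : X -> R) x e :
  compact [set: X] -> continuous f -> 0 < e -> \forall n \near \oo,
    `|ergodic_average T f (T x) n - ergodic_average T f x n| <= e.
Proof.
move=> cX cf e0; have [M M0 fM] := continuous_bounded _ _ _ cX cf.
near=> n; have n0 : 0 < n%:R :> R.
  by rewrite ltr0n; near: n; exact: nbhs_infty_gt.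
rewrite ergodic_average_shift normrM gtr0_norm ?invr_gt0// mulrC ler_pdivrMr//.
apply: (le_trans (ler_normB _ _)); apply: (le_trans (lerD (fM _) (fM _))).
rewrite mulrC -ler_pdivrMr// ltW//; near: n; exact: nbhs_infty_gtr.
Unshelve. all: by end_near. Qed.

(** This is limsup_n A_n(f, x) <= a, phrased by eventual bounds; the slack [e] can absorb the
    vanishing error of a shift by [T]. *)
Definition average_limsup_le {R : realType} {X : pmetricType R} (T : X -> X)
    (f : X -> R) (a : R) : set X :=
  [set x | forall e, 0 < e -> \forall n \near \oo,
     ergodic_average T f x n <= a + e].

(** Half of the slack pays for the shift error. The sets are equal exactly, not just up to a null
    set, as [ergodic_measure] requires. *)
Lemma average_limsup_le_invariant (R : realType) (X : pmetricType R)
    (T : X -> X) (f : X -> R) a :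
  compact [set: X] -> continuous f ->
  T @^-1` average_limsup_le T f a = average_limsup_le T f a.
Proof.
move=> cX cf; apply/seteqP; split => x xE e e0.
all: have e20 : 0 < e / 2 by rewrite divr_gt0.
all: have := ergodic_average_shift_small _ _ T f x _ cX cf e20.
all: have := xE _ e20; apply: filterS2 => n; rewrite ler_norml; lra.
Qed.

Lemma measurable_average_limsup_le (R : realType) (X : pmetricType R)
    (T : X -> X) (f : X -> R) a : continuous T -> continuous f ->
  measurable (average_limsup_le T f a : set (borel X)).
Proof.
move=> cT cf.
(* Slacks 1/(k+1) suffice, which makes all operations countable; the innermost sets are complements
   of open sets. *)
have -> : average_limsup_le T f a = \bigcap_k \bigcup_N
    \bigcap_(n in [set n | (N <= n)%N])
    ~` [set x | a + k.+1%:R^-1 < ergodic_average T f x n].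
  apply/seteqP; split => x xE.
    move=> k _; have k0 : 0 < k.+1%:R^-1 :> R by rewrite invr_gt0.
    have [N _ NE] := xE _ k0.
    by exists N => // n /= Nn; apply/negP; rewrite -leNgt; exact: NE.
  move=> e e0; have [k ke] : exists k : nat, k.+1%:R^-1 < e.
    exists (Num.truncn e^-1); rewrite invf_plt ?posrE//.
    exact: truncnS_gt.
  have [N _ NE] := xE k I; exists N => // n /= Nn.
  have := NE n Nn => /negP; rewrite -leNgt => /le_trans; apply.
  by rewrite lerD2l ltW.
apply: bigcapT_measurable => k; apply: bigcupT_measurable => N.
apply: bigcap_measurable; first by exists N => /=.
move=> n _; apply: measurableC; apply: sub_sigma_algebra.
have /continuousP := ergodic_average_continuous _ _ T f n cT cf.
by move=> /(_ _ (@open_gt R _)); exact.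
Qed.

Lemma ergodic_average_bounded (R : realType) (X : pmetricType R) (T : X -> X)
    (f : X -> R) M x n : (forall y, `|f y| <= M) ->
  `|ergodic_average T f x n| <= M.
Proof.
move=> fM; have M0 : 0 <= M := le_trans (normr_ge0 _) (fM x).
rewrite /ergodic_average; case: n => [|n]; first by rewrite invr0 mul0r normr0.
rewrite normrM gtr0_norm ?invr_gt0// mulrC ler_pdivrMr//.
apply: (le_trans (ler_norm_sum _ _ _)).
apply: (le_trans (ler_sum _ (fun i _ => fM (iter i T x)))).
by rewrite sumr_const_nat subn0 mulr_natr.
Qed.

(** The averages themselves need not converge, but their excess [g n] over [a] tends to 0 almost
    everywhere, bounded by M + |a|. Its integral dominates that of A_n - a, which by invariance is
    the integral of [f] minus [a] for all n > 0. *)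
Lemma ergodic_Rintegral_le (R : realType) (X : pmetricType R) (T : X -> X)
    (f : X -> R) (mu : probability (borel X) R) a :
  compact [set: X] -> continuous T -> continuous f -> invariant_measure T mu ->
  mu (average_limsup_le T f a) = 1%E -> \int[mu]_x f x <= a.
Proof.
move=> cX cT cf imu muE; have [M M0 fM] := continuous_bounded _ _ _ cX cf.
have mE := measurable_average_limsup_le R X T f a cT cf.
pose g n x := Num.max (ergodic_average T f x n - a) 0.
have cA n : continuous (fun x => ergodic_average T f x n - a).
  move=> x.
  apply: (@continuousB _ R^o _ (fun x => ergodic_average T f x n) (cst a)).
    exact: ergodic_average_continuous.
  exact: cst_continuous.
have cg n : continuous (g n).
  move=> x.
  apply: (@continuous_max _ _ (fun x => ergodic_average T f x n - a) (cst 0)).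
    exact: cA.
  exact: cst_continuous.
have g_cvg x : average_limsup_le T f a x -> (g n x)%:E @[n --> \oo] --> 0%E.
  move=> xE; apply: cvg_EFin; first exact: nearW.
  apply/cvgrPdist_le => e e0; have := xE e e0; apply: filterS => n An.
  rewrite /= sub0r normrN ger0_norm ?le_max ?lexx ?orbT//.
  by rewrite ge_max lerBlDl An ltW.
have mg n : measurable_fun [set: borel X] (fun x => (g n x)%:E).
  by apply/measurable_EFinP; exact: measurable_continuous.
have g_ae : {ae mu, forall x, [set: borel X] x ->
    (g n x)%:E @[n --> \oo] --> 0%E}.
  exists (~` average_limsup_le T f a); split.
  - exact: measurableC.
  - by rewrite probability_setC// muE subee.
  - by apply: subsetC => x xE _; exact: g_cvg.
have g_le : {ae mu, forall x n, [set: borel X] x ->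
    (`|(g n x)%:E| <= (EFin \o cst (M + `|a|)%R) x)%E}.
  apply: aeW => x n _; rewrite lee_fin ger0_norm ?le_max ?lexx ?orbT//.
  rewrite ge_max addr_ge0// andbT; apply: (le_trans (ler_norm _)).
  by apply: (le_trans (ler_normB _ _)); rewrite lerD2r ergodic_average_bounded.
have [_ _] := @dominated_convergence _ (borel X) R mu setT measurableT
  (fun n x => (g n x)%:E) (cst 0%E) (EFin \o cst (M + `|a|)) mg
  (measurable_cst _) g_ae (finite_measure_integrable_cst _ _ measurableT) g_le.
rewrite integral0 => int_cvg.
rewrite -subr_le0 -lee_fin; apply: (cvge_to_ge int_cvg).
(* Index 0 is skipped: the average there is 0 by convention. *)
exists 1%N => // n /= n0.
have <- : \int[mu]_x (ergodic_average T f x n - a) = \int[mu]_x f x - a.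
  rewrite RintegralB//; last exact: finite_measure_integrable_cst.
    rewrite Rintegral_ergodic_average// Rintegral_cst//.
    rewrite (_ : fine _ = 1) ?mulr1//.
    transitivity (fine (1%E : \bar R)) => //; congr fine.
    exact: probability_setT.
  exact/continuous_integrable/ergodic_average_continuous.
rewrite /Rintegral fineK.
  apply: le_integral => //.
  - exact: continuous_integrable.
  - exact: continuous_integrable.
  - by move=> x _; rewrite lee_fin le_max lexx.
exact/integrable_fin_num/continuous_integrable.
Qed.

(** * Density of large averages from full support *)

Lemma ergodic_average_gt_meets (R : realType) (X : pmetricType R) (T : X -> X)
    (f : X -> R) (mu : probability (borel X) R) a (U : set X) N :
  compact [set: X] -> continuous T -> continuous f ->
  ergodic_measure T mu -> full_support mu -> a < \int[mu]_x f x ->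
  open U -> U !=set0 ->
  exists x n, [/\ U x, (N <= n)%N & a < ergodic_average T f x n].
Proof.
move=> cX cT cf [imu emu] smu af oU U0; apply: contrapT => nU.
have mE := measurable_average_limsup_le R X T f a cT cf.
have UE : U `<=` average_limsup_le T f a.
  move=> x Ux e e0; exists N => // n /= Nn; rewrite leNgt; apply/negP => lt_an.
  by apply: nU; exists x, n; split => //; apply: lt_trans lt_an; rewrite ltrDl.
(* Measure 0 is impossible because the set contains the nonempty open [U]; measure 1 would force the
   integral of [f] to be at most [a]. *)
have [muE|muE] := emu _ mE (average_limsup_le_invariant _ _ T f a cX cf).
  have := smu U oU U0; rewrite ltNge -muE => /negP; apply.
  apply: (@le_measure _ _ (borel X) mu) => //; rewrite inE//.
  exact: sub_sigma_algebra.
have := ergodic_Rintegral_le _ _ _ _ _ _ cX cT cf imu muE.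
by rewrite leNgt af.
Qed.

Lemma open_dense_average_gt (R : realType) (X : pmetricType R) (T : X -> X)
    (f : X -> R) (mu : probability (borel X) R) a N :
  compact [set: X] -> continuous T -> continuous f ->
  ergodic_measure T mu -> full_support mu -> a < \int[mu]_x f x ->
  let O := \bigcup_(n in [set n | (N <= n)%N])
    [set x | a < ergodic_average T f x n] in
  open O /\ dense O.
Proof.
move=> cX cT cf emu smu af O; split.
  apply: bigcup_open => n _.
  have /continuousP := ergodic_average_continuous _ _ T f n cT cf.
  by move=> /(_ _ (@open_gt R a)); exact.
move=> U U0 oU.
have [x [n [Ux Nn an]]] :=
  ergodic_average_gt_meets _ _ T f mu a U N cX cT cf emu smu af oU U0.
by exists x; split => //; exists n.
Qed.

(** * Oscillation on a residual set *)

Lemma oscillating_not_cvg (R : realType) (u : R^nat) a b : b < a ->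
  (forall N, exists2 n, (N <= n)%N & a < u n) ->
  (forall N, exists2 n, (N <= n)%N & u n < b) -> ~ cvgn u.
Proof.
(* Terms within half the gap of a limit are less than a - b apart, whereas a late term above [a] and
   one below [b] differ by more. *)
move=> ba ua ub cu; have e0 : 0 < (a - b) / 2 by rewrite divr_gt0// subr_gt0.
have /cvgrPdist_lt/(_ _ e0)[N _ Nu] := cu.
have [n /Nu + un] := ua N; have [m /Nu + um] := ub N.
rewrite /= !ltr_norml; lra.
Qed.

Lemma ergodic_averageN (R : realType) (X : pmetricType R) (T : X -> X)
    (f : X -> R) x n :
  ergodic_average T (\- f) x n = - ergodic_average T f x n.
Proof. by rewrite /ergodic_average sumrN mulrN. Qed.

Lemma residual_oscillation (R : realType) (X : pmetricType R) (T : X -> X)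
    (f : X -> R) (mu nu : probability (borel X) R) :
  compact [set: X] -> continuous T -> continuous f ->
  ergodic_measure T mu -> ergodic_measure T nu ->
  full_support mu -> full_support nu -> \int[nu]_x f x < \int[mu]_x f x ->
  exists B : set X,
    [/\ Gdelta B, dense B & forall x, B x -> ~ cvgn (ergodic_average T f x)].
Proof.
move=> cX cT cf emu enu smu snu numu.
have [b [a [nub ba amu]]] : exists b a,
    [/\ \int[nu]_x f x < b, b < a & a < \int[mu]_x f x].
  set p := \int[nu]_x f x in numu *; set q := \int[mu]_x f x in numu *.
  (* The points at one third and two thirds of the way from [p] to [q]. *)
  by exists ((p + p + q) / 3), ((p + q + q) / 3); split; lra.
have cNf : continuous (\- f) by move=> x; apply: continuousN; exact: cf.
have bnu : - b < \int[nu]_x (\- f) x.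
  have -> : \int[nu]_x (\- f) x = - \int[nu]_x f x.
    transitivity (\int[nu]_x (-1 * f x)).
      by apply: eq_Rintegral => x _; rewrite mulN1r.
    by rewrite RintegralZl ?mulN1r//; exact: continuous_integrable.
  by rewrite ltrN2.
have hP N := open_dense_average_gt _ _ T f mu a N cX cT cf emu smu amu.
have hQ N := open_dense_average_gt _ _ T _ nu _ N cX cT cNf enu snu bnu.
pose P N := \bigcup_(n in [set n | (N <= n)%N])
    [set x | a < ergodic_average T f x n].
pose Q N := \bigcup_(n in [set n | (N <= n)%N])
    [set x | - b < ergodic_average T (\- f) x n].
(* Pairing both conditions at the same [N] gives a single sequence of open dense sets, serving both
   Baire and the G-delta property. *)
have oPQ N : open (P N `&` Q N) by apply: openI; [case: (hP N)|case: (hQ N)].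
exists (\bigcap_N (P N `&` Q N)); split; first by exists (fun N => P N `&` Q N).
  apply: compact_regular_baire => //; first exact: uniform_regular.
  move=> N; have [? ?] := hP N; have [? ?] := hQ N; exact: denseI.
move=> x Bx; apply: (@oscillating_not_cvg _ _ a b) => // N.
  by have [[n Nn an] _] := Bx N I; exists n.
have [_ [n Nn bn]] := Bx N I; exists n => //.
by move: bn; rewrite /= ergodic_averageN ltrN2.
Qed.

Theorem theorem1p1 (R : realType) (X : pmetricType R) (T : X -> X)
    (mu nu : probability (borel X) R) :
  topological_dynamical_system T ->
  ergodic_measure T mu -> ergodic_measure T nu ->
  different_measures mu nu ->
  full_support mu -> full_support nu ->
  exists (B : set X) (f : X -> R),
    [/\ Gdelta B, dense B, continuous f &
        forall x, B x -> ~ cvgn (ergodic_average T f x)].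
Proof.
move=> [cX cT _] emu enu [A mA muA] smu snu.
have [f cf fmunu] : exists2 f : X -> R, continuous f &
    \int[mu]_x f x != \int[nu]_x f x.
  apply: contrapT => nf; apply: muA.
  apply: probability_eq_continuous mA => f cf; apply: contrapT => fmunu.
  apply: nf; exists f => //; apply: contra_notN fmunu => /eqP.
  (* [Rintegral] is the real part of an extended integral, so finiteness is needed to recover
     equality of the extended integrals. *)
  have fin (P : probability (borel X) R) :
      (\int[P]_x (f x)%:E)%E \is a fin_num.
    by apply: integrable_fin_num => //; exact: continuous_integrable.
  rewrite /Rintegral => fineE.
  by rewrite -(fineK (fin mu)) -(fineK (fin nu)) fineE.
(* The measures play symmetric roles: the one with the larger integral forces the high averages. *)
move: fmunu; rewrite neq_lt => /orP[munu|numu].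
  have [B [GB dB oB]] :=
    residual_oscillation _ _ T f nu mu cX cT cf enu emu snu smu munu.
  by exists B, f.
have [B [GB dB oB]] :=
  residual_oscillation _ _ T f mu nu cX cT cf emu enu smu snu numu.
by exists B, f.
Qed.
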